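(* Let $S\subseteq \mathbb{Z}[x]$ be finite. Let $M = T + x\cdot u\cdot v^\top\in\mathbb{Z}[x]^{m\times n}$, where $T\in\mathbb{Z}^{m\times n}$, $u\in\mathbb{Z}^m$ and $v\in\mathbb{Z}^n$ are integral. If $M$ is totally $S$-modular, then $T$ is totally $S(0)$-modular.
   Context: $\mathbb{Z}[x]$ is the ring of polynomials in one indeterminate $x$ with integer coefficients. For $S\subseteq\mathbb{Z}[x]$, a matrix $M\in\mathbb{Z}[x]^{m\times n}$ (with $m,n\ge 1$) is totally $S$-modular if for every $1\le k\le\min\{m,n\}$ the determinant of every $k\times k$ submatrix of $M$ lies in $S$. The same definition is used for integer matrices and sets of integers, regarding integers as constant polynomials. For $a\in\mathbb{Z}$, $S(a)=\{s(a): s\in S\}\subseteq\mathbb{Z}$ is the set of evaluations at $a$ of the polynomials in $S$. *)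

(* Defs.v *)
From HB Require Import structures.
From mathcomp Require Import all_boot all_order all_algebra.
From mathcomp Require Import classical_sets.

Set Implicit Arguments.
Unset Strict Implicit.
Unset Printing Implicit Defensive.

Import GRing.Theory.
Local Open Scope classical_set_scope.
Local Open Scope ring_scope.

(* A k x k submatrix is given by the strictly increasing enumerations f and g
   of the selected rows and columns. *)
Definition totally_modular (R : comNzRingType) (S : set R) (m n : nat)
    (M : 'M[R]_(m, n)) : Prop :=
  forall k : nat, (1 <= k <= minn m n)%N ->
  forall (f : 'I_k -> 'I_m) (g : 'I_k -> 'I_n),
    {homo f : i j / (i < j)%N} -> {homo g : i j / (i < j)%N} ->
    S (\det (mxsub f g M)).

Definition eval_set (S : set {poly int}) (a : int) : set int :=
  [set s.[a] | s in S].

(* Main.v *)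
Require Import Defs.
From HB Require Import structures.
From mathcomp Require Import all_boot all_order all_algebra.
From mathcomp Require Import classical_sets cardinality.

Set Implicit Arguments.
Unset Strict Implicit.
Unset Printing Implicit Defensive.

Import GRing.Theory.
Local Open Scope classical_set_scope.
Local Open Scope ring_scope.

Theorem theorem1 (S : set {poly int}) (hS : finite_set S)
    (m n : nat) (hm : (1 <= m)%N) (hn : (1 <= n)%N)
    (T : 'M[int]_(m, n)) (u : 'cV[int]_m) (v : 'cV[int]_n)
    (M : 'M[{poly int}]_(m, n))
    (hM : M = map_mx polyC T
              + 'X *: (map_mx polyC u *m (map_mx polyC v)^T)) :
  totally_modular S M -> totally_modular (eval_set S 0) T.
Proof.
(* The witness is the minor of [M] on the same rows and columns: it lies in [S], and its value at 0
   will be the minor of [T]. *)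
move=> SM k hk f g hf hg; exists (\det (mxsub f g M)); first exact: SM.
(* Evaluation at 0 is a ring morphism, so it commutes with the determinant; folding to [horner_eval]
   exposes that morphism. *)
rewrite -/(horner_eval 0 _) -det_map_mx; congr (\det _).
(* Entrywise, the rank-one term carries a factor ['X], which vanishes at 0 whatever its cofactor. *)
by apply/matrixP => i j; rewrite hM !mxE /= /horner_eval hornerD hornerC hornerM hornerX mul0r addr0.
Qed.
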